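(* The moduli space $\Sigma_2$ of $\mathcal{A}_2^{\alpha,\beta}$ is formed by the arrangements $\mathcal{M}_\gamma^{\kappa_1,\kappa_2}$ composed of the lines $$L_1:y=0,\quad L_2:x=0,\quad L_3:z=0,\quad L_4:x+y+z=0,$$ $$L_5:\gamma x+\gamma y+z=0,\quad L_6:x+\gamma y+z=0,\quad L_7:\gamma x+y+z=0,$$ $$L_8:\kappa_1^{-1}x+\kappa_1y+z=0,\quad L_9:x+\kappa_1y+z=0,\quad L_{10}:\kappa_1^{-1}x+y+z=0,$$ $$L_{11}:\kappa_2x+\kappa_2^{-1}y+z=0,\quad L_{12}:\kappa_2x+y+z=0,\quad L_{13}:x+\kappa_2^{-1}y+z=0,$$ where $\kappa_1^2=\kappa_2^2=\gamma\in\mathbb{C}^*$ satisfying $\kappa_1^3\neq1$, $\kappa_2^3\neq1$, $\kappa_1\kappa_2\neq1$ and: (1) if $\kappa_1=\kappa_2$: $2\kappa_1^2+\kappa_1+1\neq0$, $2\kappa_1^2+2\kappa_1+1\neq0$, $\kappa_1\neq-1/2$, $\kappa_1^3+3\kappa_1^2+2\kappa_1+1\neq0$, and $\kappa_1^3+2\kappa_1^2+\kappa_1+1\neq0$; (2) if $\kappa_1=-\kappa_2$: $\kappa_1^3+\kappa_1^2+1\neq0$, $\kappa_1^3-\kappa_1^2-1\neq0$, $2\kappa_1^2+1\neq0$, $\kappa_1^3+\kappa_1-1\neq0$, and $\kappa_1^3+\kappa_1+1\neq0$.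
   Context: The combinatorics of a line arrangement (a finite set of distinct lines in $\mathbb{CP}^2$) is the collection of all triples of its lines concurrent at a point; two arrangements have the same combinatorics, written $\mathcal{B}\sim\mathcal{A}$, if there is a bijection between them respecting incidence relations. The moduli space of an arrangement $\mathcal{A}$ of $n$ lines is $\Sigma_{\mathcal{A}}=\{\mathcal{B}\in(\check{\mathbb{CP}}^2)^n\mid\mathcal{B}\sim\mathcal{A}\}/\mathrm{PGL}_3(\mathbb{C})$, where $\check{\mathbb{CP}}^2$ is the dual projective plane (the set of lines of $\mathbb{CP}^2$). The four arrangements $\mathcal{A}_2^{\alpha,\beta}$, $\alpha,\beta\in\{-1,1\}$, all have the same combinatorics and consist of the 13 lines $P^\bullet=\{ax+by+cz=0\}\subset\mathbb{CP}^2$ for $P=(a:b:c)$ among the points $V_1=(0:1:0)$, $V_2=(1:0:0)$, $V_3=(0:0:1)$, $S_1=(1:1:1)$, $S_2=(4:4:1)$, $S_3=(1:4:1)$, $S_4=(4:1:1)$, $S_5=(1:4:2\alpha)$, $S_6=(1:2\alpha:1)$, $S_7=(\alpha:2:2)$, $S_8=(4:1:2\beta)$, $S_9=(2\beta:1:1)$, $S_{10}=(2:\beta:2)$. The maximal sets of at least three concurrent lines are the duals of: $\{V_1,S_1,S_3,S_6,S_{10}\}$, $\{V_1,S_2,S_4\}$, $\{V_1,S_5,S_7\}$, $\{V_1,S_8,S_9\}$, $\{V_2,S_1,S_4,S_7,S_9\}$, $\{V_2,S_2,S_3\}$, $\{V_2,S_5,S_6\}$, $\{V_2,S_8,S_{10}\}$,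 $\{V_3,S_1,S_2\}$, $\{V_3,S_3,S_5\}$, $\{V_3,S_4,S_8\}$, $\{V_3,S_6,S_7\}$, $\{V_3,S_9,S_{10}\}$. The lines $L_1,\dots,L_{13}$ correspond to $V_1^\bullet,V_2^\bullet,V_3^\bullet,S_1^\bullet,\dots,S_{10}^\bullet$ in this order.
   Formalization: The condition γ ≠ −1 is added: for κ₁ = κ₂ = ±i all the printed conditions hold, but L₃, L₆, L₇ meet at (1:1:0) while the corresponding lines of A₂ are not concurrent, so that arrangement is not in the moduli space. *)

(* Defs.v *)
From mathcomp Require Import all_boot all_order all_algebra all_fingroup.
From mathcomp Require Import complex.
From mathcomp Require Import classical_sets reals.

Set Implicit Arguments.
Unset Strict Implicit.
Unset Printing Implicit Defensive.

Import GRing.Theory.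
Local Open Scope ring_scope.
Local Open Scope classical_set_scope.

Section Arrangements.
Variable R : realType.

(* A line of CP^2 is encoded by the subspace of linear forms (row vectors)
   vanishing on it; the elements of the dual projective plane are those of
   dimension 1.  Points of CP^2 are represented by nonzero column vectors. *)
Notation line := {vspace 'rV[R[i]]_3}.

Definition linear_form (a b c : R[i]) : 'rV[R[i]]_3 :=
  \row_(j < 3) nth 0 [:: a; b; c] j.

(* The line ax + by + cz = 0. *)
Definition line_of (a b c : R[i]) : line := <[linear_form a b c]>%VS.

Definition lies_on (p : 'cV[R[i]]_3) (L : line) : Prop :=
  forall v : 'rV[R[i]]_3, v \in L -> v *m p = 0.

Definition concurrent (L1 L2 L3 : line) : Prop :=
  exists p : 'cV[R[i]]_3,
    [/\ p <> 0, lies_on p L1, lies_on p L2 & lies_on p L3].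

Section Combinatorics.
Variable n : nat.
Implicit Types (A B : n.-tuple line) (s : 'S_n).

Definition arrangement B : Prop :=
  uniq B /\ forall i : 'I_n, \dim (tnth B i) = 1%N.

(* The bijection [tnth A i |-> tnth B (s i)] preserves and reflects the set of
   concurrent triples of distinct lines. *)
Definition respects_incidence A B s : Prop :=
  forall i j k : 'I_n, uniq [:: i; j; k] ->
    (concurrent (tnth A i) (tnth A j) (tnth A k) <->
     concurrent (tnth B (s i)) (tnth B (s j)) (tnth B (s k))).

Definition same_combinatorics A B : Prop :=
  exists s, respects_incidence A B s.

(* The projective transformation p |-> g p sends the line of equation v p = 0
   to the line of equation (v g^-1) p = 0. *)
Definition line_image (g : 'M[R[i]]_3) (L : line) : line :=
  (linfun (mulmxr (invmx g)) @: L)%VS.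

(* Scalar matrices act trivially, so orbits under GL_3 and PGL_3 coincide. *)
Definition proj_equiv A B : Prop :=
  exists2 g : 'M[R[i]]_3, g \in unitmx & B = map_tuple (line_image g) A.

Definition proj_class A : set (n.-tuple line) := [set B | proj_equiv A B].

Definition moduli_space A : set (set (n.-tuple line)) :=
  [set proj_class B | B in [set B | arrangement B /\ same_combinatorics A B]].

(* The same quotient when only the bijection matching the i-th line of A with
   the i-th line of B is allowed. *)
Definition ordered_moduli_space A : set (set (n.-tuple line)) :=
  [set proj_class B |
     B in [set B | arrangement B /\ respects_incidence A B 1%g]].

Definition relabel s A : n.-tuple line := [tuple tnth A (s i) | i < n].

End Combinatorics.

Definition arrA2 (a b : R[i]) : 13.-tuple line :=
  [tuple line_of 0 1 0;
         line_of 1 0 0;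
         line_of 0 0 1;
         line_of 1 1 1;
         line_of 4 4 1;
         line_of 1 4 1;
         line_of 4 1 1;
         line_of 1 4 (2 * a);
         line_of 1 (2 * a) 1;
         line_of a 2 2;
         line_of 4 1 (2 * b);
         line_of (2 * b) 1 1;
         line_of 2 b 2].

Definition arrM (g k1 k2 : R[i]) : 13.-tuple line :=
  [tuple line_of 0 1 0;
         line_of 1 0 0;
         line_of 0 0 1;
         line_of 1 1 1;
         line_of g g 1;
         line_of 1 g 1;
         line_of g 1 1;
         line_of k1^-1 k1 1;
         line_of 1 k1 1;
         line_of k1^-1 1 1;
         line_of k2 k2^-1 1;
         line_of k2 1 1;
         line_of 1 k2^-1 1].

(* These conditions do not exclude g = -1 with k1 = k2 = +-i, for which the
   lines z = 0, x + g y + z = 0 and g x + y + z = 0 meet at (1:1:0), although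
   the corresponding lines of arrA2 are not concurrent. *)
Definition admissible (g k1 k2 : R[i]) : Prop :=
  [/\ [/\ k1 ^+ 2 = g, k2 ^+ 2 = g & g <> 0],
      [/\ k1 ^+ 3 <> 1, k2 ^+ 3 <> 1 & k1 * k2 <> 1],
      k1 = k2 ->
        [/\ 2 * k1 ^+ 2 + k1 + 1 <> 0,
            2 * k1 ^+ 2 + 2 * k1 + 1 <> 0,
            k1 <> - (1 / 2),
            k1 ^+ 3 + 3 * k1 ^+ 2 + 2 * k1 + 1 <> 0 &
            k1 ^+ 3 + 2 * k1 ^+ 2 + k1 + 1 <> 0] &
      k1 = - k2 ->
        [/\ k1 ^+ 3 + k1 ^+ 2 + 1 <> 0,
            k1 ^+ 3 - k1 ^+ 2 - 1 <> 0,
            2 * k1 ^+ 2 + 1 <> 0,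
            k1 ^+ 3 + k1 - 1 <> 0 &
            k1 ^+ 3 + k1 + 1 <> 0]].

End Arrangements.

(* Main.v *)
Require Import Defs.
From mathcomp Require Import all_boot all_order all_algebra all_fingroup.
From mathcomp Require Import complex.
From mathcomp Require Import boolp classical_sets reals ring.

(* Three lines are concurrent iff the determinant of their coefficients
   vanishes.  As [k2 = k1] or [k2 = - k1], the determinants of the triples of
   lines of [arrM] are, up to sign and powers of [k1], integer polynomials in [k1]; those
   of non-incident triples split into factors whose non-vanishing is exactly
   admissibility together with [g <> -1], and each factor divides one of them.
   Moreover [arrA2 a b] is [arrM] at [g = 4], [k1 = 2 a], [k2 = 2 b], so it has
   the same incidences.  Conversely, an arrangement with these incidences is
   normalized by sending the frame [V1, V2, V3, S1] to the standard one; its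
   other lines are then [x X + y Y + Z = 0] with [x], [y] nonzero, and the
   pencils through the frame lines force the shape of [arrM]. *)

Set Implicit Arguments.
Unset Strict Implicit.
Unset Printing Implicit Defensive.

Import Order.TTheory GRing.Theory Num.Theory.
Local Open Scope ring_scope.
Local Open Scope classical_set_scope.

(** * Integer polynomials as coefficient lists *)


Fixpoint padd (p q : seq int) : seq int :=
  match p, q with
  | [::], _ => q
  | _, [::] => p
  | a :: p', b :: q' => a + b :: padd p' q'
  end.

Definition pscale (c : int) (p : seq int) : seq int := [seq c * a | a <- p].

Definition psub (p q : seq int) : seq int := padd p (pscale (-1) q).

Fixpoint pmul (p q : seq int) : seq int :=
  if p is a :: p' then padd (pscale a q) (0 :: pmul p' q) else [::].

Definition pzero (p : seq int) : bool := all (fun a => a == 0) p.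

(* Long division from the constant coefficients up: this is the quotient only if
   [f] divides [p] and the constant coefficient of [f] is 1 or -1. *)
Fixpoint pquo (n : nat) (p f : seq int) : seq int :=
  if n is n'.+1 then
    let c := head 0 p * head 0 f in
    c :: pquo n' (behead (psub p (pscale c f))) f
  else [::].

(** The candidate quotient is checked by multiplying back, so soundness does not rest on [pquo]
    being a correct division. *)
Definition pdivide (p f : seq int) : option (seq int) :=
  let q := pquo (size p) p f in
  if pzero (psub p (pmul q f)) then Some q else None.

(* [n] is the fuel. *)
Fixpoint splits (n : nat) (fs : seq (seq int)) (p : seq int) : bool :=
  if n is n'.+1 then
    if p is a :: p' then
      if pzero p' then a != 0
      else if a == 0 then splits n' fs p'
      else if pmap (pdivide p) fs is q :: _ then splits n' fs q else false
    else false
  else false.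

Section Evaluation.
Variable F : comNzRingType.
Implicit Types (x : F) (p q f : seq int).

Fixpoint peval x p : F := if p is a :: p' then a%:~R + x * peval x p' else 0.

Lemma peval_add x p q : peval x (padd p q) = peval x p + peval x q.
Proof.
elim: p q => [|a p IH] [|b q] /=; rewrite ?add0r ?addr0 //.
by rewrite IH intrD; ring.
Qed.

Lemma peval_scale x c p : peval x (pscale c p) = c%:~R * peval x p.
Proof. by elim: p => [|a p IH] /=; rewrite ?mulr0 // IH intrM; ring. Qed.

Lemma peval_sub x p q : peval x (psub p q) = peval x p - peval x q.
Proof. by rewrite peval_add peval_scale mulN1r. Qed.

Lemma peval_mul x p q : peval x (pmul p q) = peval x p * peval x q.
Proof.
elim: p => [|a p IH] /=; first by rewrite mul0r.
by rewrite peval_add peval_scale /= IH; ring.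
Qed.

Lemma peval_pzero x p : pzero p -> peval x p = 0.
Proof.
by elim: p => [|a p IH] //= /andP[/eqP -> /IH ->]; rewrite mulr0 addr0.
Qed.

Lemma peval_pdivide x p f q :
  pdivide p f = Some q -> peval x p = peval x q * peval x f.
Proof.
rewrite /pdivide; case: ifP => // p0 [<-].
by move/(peval_pzero x)/eqP: p0; rewrite peval_sub peval_mul subr_eq0 => /eqP.
Qed.

End Evaluation.

(** Reduces evaluation at an integer point of any ring to a computation in [int]; this serves the
    parameters [2 * a] and [2 * b] of [arrA2]. *)
Lemma peval_int (F : comNzRingType) (m : int) (p : seq int) :
  peval (m%:~R : F) p = (peval m p)%:~R.
Proof. by elim: p => [|a p IH] //=; rewrite IH intz rmorphD rmorphM. Qed.

(** Each step of [splits] divides out [x] or a listed factor, none of which vanishes at [x]. What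
    remains at the end is a nonzero integer constant, and it stays nonzero in characteristic 0. *)
Lemma peval_splits (F : numDomainType) (x : F) n (fs : seq (seq int))
    (p : seq int) :
  x != 0 -> (forall f, f \in fs -> peval x f != 0) ->
  splits n fs p -> peval x p != 0.
Proof.
move=> x0 fs0; elim: n p => [|n IH] [|a p] //=.
case: ifP => [p0 a0|_]; first by rewrite peval_pzero // mulr0 addr0 intr_eq0.
case: eqP => [-> /IH p0|_]; first by rewrite mulr0z add0r mulf_neq0.
case E: pmap => [|q s] // /IH q0.
have : q \in pmap (pdivide (a :: p)) fs by rewrite E mem_head.
rewrite mem_pmap => /mapP[f /fs0 f0 /esym/(peval_pdivide x)] /= ->.
exact: mulf_neq0.
Qed.

(** * Determinants of triples of lines and their factorization *)

Definition det3 (K : comNzRingType) (u v w : seq K) : K :=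
  u`_0 * (v`_1 * w`_2 - v`_2 * w`_1) - u`_1 * (v`_0 * w`_2 - v`_2 * w`_0)
  + u`_2 * (v`_0 * w`_1 - v`_1 * w`_0).

Definition pdet3 (u v w : seq (seq int)) : seq int :=
  let m i j := psub (pmul (nth [::] v i) (nth [::] w j))
                    (pmul (nth [::] v j) (nth [::] w i)) in
  padd (psub (pmul (nth [::] u 0) (m 1 2)) (pmul (nth [::] u 1) (m 0 2)))
       (pmul (nth [::] u 2) (m 0 1)).

Lemma peval_pdet3 (F : comNzRingType) (x : F) (u v w : seq (seq int)) :
  peval x (pdet3 u v w) =
  det3 (map (peval x) u) (map (peval x) v) (map (peval x) w).
Proof.
(* Out of range the two defaults agree, since the empty list evaluates to 0. *)
have nthE (s : seq (seq int)) i : (map (peval x) s)`_i = peval x (nth [::] s i).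
  have [lt_i|le_i] := ltnP i (size s); first by rewrite (nth_map [::]).
  by rewrite !nth_default ?size_map.
by rewrite /det3 !nthE /pdet3 /= !(peval_add, peval_sub, peval_mul).
Qed.

(* Lines are numbered from 0: [V_1], [V_2], [V_3] are 0, 1, 2 and [S_i] is [i + 2]. *)
Definition pencils : seq (seq nat) :=
  [:: [:: 0; 3; 5; 8; 12]; [:: 0; 4; 6]; [:: 0; 7; 9]; [:: 0; 10; 11];
      [:: 1; 3; 6; 9; 11]; [:: 1; 4; 5]; [:: 1; 7; 8]; [:: 1; 10; 12];
      [:: 2; 3; 4]; [:: 2; 5; 7]; [:: 2; 6; 10]; [:: 2; 8; 9];
      [:: 2; 11; 12]]%N.

Definition incident (i j k : nat) : bool :=
  has (fun s => all (mem s) [:: i; j; k]) pencils.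

(* The lines of [arrM] for [k2 = e * k1] with [e = 1] or [e = -1], as
   polynomials in [k1], after multiplication by 1, [k1] or [k2]. *)
Definition plines (e : int) : seq (seq (seq int)) :=
  let o := [:: 1] in let k := [:: 0; 1] in let g := [:: 0; 0; 1] in
  let l := [:: 0; e] in
  [:: [:: [::]; o; [::]]; [:: o; [::]; [::]]; [:: [::]; [::]; o]; [:: o; o; o];
      [:: g; g; o]; [:: o; g; o]; [:: g; o; o];
      [:: o; g; k]; [:: o; k; o]; [:: o; k; k];
      [:: g; o; l]; [:: l; o; o]; [:: l; o; l]].

(** The factors other than the conditions specific to the sign [e] come from [k1 ^+ 3 - 1],
    [k2 ^+ 3 - 1], [k1 * k2 - 1] and [g + 1]. All constant coefficients are 1 or -1, as [pquo]
    requires. *)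
Definition pfactors (e : int) : seq (seq int) :=
  if e == 1 then
    [:: [:: -1; 1]; [:: 1; 1; 1]; [:: 1; 1]; [:: 1; 0; 1];
        [:: 1; 1; 2]; [:: 1; 2; 2]; [:: 1; 2]; [:: 1; 2; 3; 1]; [:: 1; 1; 2; 1]]
  else
    [:: [:: -1; 1]; [:: 1; 1; 1]; [:: 1; 1]; [:: 1; -1; 1]; [:: 1; 0; 1];
        [:: 1; 0; 1; 1]; [:: -1; 0; -1; 1]; [:: 1; 0; 2];
        [:: -1; 1; 0; 1]; [:: 1; 1; 0; 1]].

Definition pminor (e : int) (i j k : nat) : seq int :=
  pdet3 (nth [::] (plines e) i) (nth [::] (plines e) j) (nth [::] (plines e) k).

(** Fuel 12 is ample: entries have degree at most 2, so minors have degree at most 6, and each step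
    of [splits] lowers the degree. *)
Definition incidence_check (e : int) : bool :=
  all (fun i => all (fun j => all (fun k =>
    if uniq [:: i; j; k] then
      if incident i j k then pzero (pminor e i j k)
      else splits 12 (pfactors e) (pminor e i j k)
    else true) (iota 0 13)) (iota 0 13)) (iota 0 13).

(** A root of a factor dividing the minor of a non-incident triple makes that triple concurrent.
    This is what makes the non-vanishing conditions necessary. *)
Definition factors_check (e : int) : bool :=
  all (fun f => has (fun i => has (fun j => has (fun k =>
    [&& uniq [:: i; j; k], ~~ incident i j k
      & isSome (pdivide (pminor e i j k) f)])
    (iota 0 13)) (iota 0 13)) (iota 0 13)) (pfactors e).

Lemma factors_check1 : factors_check 1.
Proof. by vm_compute. Qed.

Lemma factors_checkN1 : factors_check (-1).
Proof. by vm_compute. Qed.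

Lemma incidence_check1 : incidence_check 1.
Proof. by vm_compute. Qed.

Lemma incidence_checkN1 : incidence_check (-1).
Proof. by vm_compute. Qed.

(** * Lines, concurrency and projective transformations *)

Lemma det_mx33 (K : comNzRingType) (A : 'M[K]_3) :
  \det A = A 0 0 * (A 1 1 * A ord_max ord_max - A 1 ord_max * A ord_max 1)
    - A 0 1 * (A 1 0 * A ord_max ord_max - A 1 ord_max * A ord_max 0)
    + A 0 ord_max * (A 1 0 * A ord_max 1 - A 1 1 * A ord_max 0).
Proof.
(* Cofactor expansion produces ordinals in various shapes; indexing by naturals makes equal entries
   syntactically equal for [ring]. *)
pose f i j := A (inord i) (inord j).
have AE i j : A i j = f i j by rewrite /f !inord_val.
rewrite (expand_det_row _ 0) !big_ord_recl big_ord0 /cofactor.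
rewrite !(expand_det_row _ 0) !big_ord_recl !big_ord0 /cofactor !det_mx11 !mxE.
rewrite !AE /= /bump /= !addn0 !add0n !expr0 !expr1 sqrrN expr1n.
ring.
Qed.

Section Lines.
Variable R : realType.
Local Notation C := R[i].
Local Notation line := {vspace 'rV[C]_3}.

Lemma rV3E (v : 'rV[C]_3) : v = linear_form (v 0 0) (v 0 1) (v 0 (ord_max)).
Proof.
apply/rowP => j; rewrite mxE; case: j => -[|[|[|//]]] lt /=;
  congr (v 0 _); exact: val_inj.
Qed.

Lemma line_of_scale (c x y z : C) :
  c != 0 -> line_of (c * x) (c * y) (c * z) = line_of x y z.
Proof.
move=> c0; rewrite /line_of.
have -> : linear_form (c * x) (c * y) (c * z) = c *: linear_form x y z.
  by apply/rowP => j; rewrite !mxE; case: j => -[|[|[|//]]].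
apply/vspaceP => w; apply/vlineP/vlineP => -[k ->].
  by exists (k * c); rewrite scalerA.
by exists (k / c); rewrite scalerA divfK.
Qed.

Lemma line_of_eq (c x y z x' y' z' : C) :
  c != 0 -> x' = c * x -> y' = c * y -> z' = c * z ->
  line_of x y z = line_of x' y' z'.
Proof. by move=> c0 -> -> ->; rewrite line_of_scale. Qed.

Lemma lies_on_vline (p : 'cV[C]_3) (v : 'rV[C]_3) :
  lies_on p <[v]>%VS <-> v *m p = 0.
Proof.
split=> [|vp w /vlineP[c ->]]; first by apply; exact: memv_line.
by rewrite -scalemxAl vp scaler0.
Qed.

(** A common point is a nonzero vector in the right kernel of the coefficient matrix [M]; [det0P]
    speaks of left kernels, hence the transposes. *)
Lemma concurrent_line_of (u v w : seq C) :
  concurrent (line_of u`_0 u`_1 u`_2) (line_of v`_0 v`_1 v`_2)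
    (line_of w`_0 w`_1 w`_2) <-> det3 u v w = 0.
Proof.
pose row3 (s : seq C) := linear_form s`_0 s`_1 s`_2.
pose M := \matrix_(i < 3) nth 0 [:: row3 u; row3 v; row3 w] i.
have detM : \det M = det3 u v w.
  rewrite det_mx33.
  by rewrite !mxE.
have rowM i : row i M = nth 0 [:: row3 u; row3 v; row3 w] i by rewrite rowK.
split=> [[p [p0 /lies_on_vline up /lies_on_vline vp /lies_on_vline wp]]|d0].
  apply/eqP; rewrite -detM -det_tr; apply/det0P; exists p^T.
    by rewrite trmx_eq0; apply/eqP.
  rewrite -trmx_mul; apply/eqP; rewrite trmx_eq0; apply/eqP/row_matrixP => i.
  rewrite row_mul rowM row0; case: i => -[|[|[|i]]] lt;
    [exact: up | exact: vp | exact: wp | by []].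
have /det0P[q q0 qM] : \det M^T == 0 by rewrite det_tr detM d0.
exists q^T; have Mq : M *m q^T = 0 by rewrite -[M]trmxK -trmx_mul qM trmx0.
split; first by apply/eqP; rewrite trmx_eq0.
- by apply/lies_on_vline; rewrite -[linear_form _ _ _](rowM 0) -row_mul Mq row0.
- by apply/lies_on_vline; rewrite -[linear_form _ _ _](rowM 1) -row_mul Mq row0.
- apply/lies_on_vline.
  by rewrite -[linear_form _ _ _](rowM (ord_max)) -row_mul Mq row0.
Qed.

Lemma concurrent_of3 (a b c a' b' c' a'' b'' c'' : C) :
  concurrent (line_of a b c) (line_of a' b' c') (line_of a'' b'' c'') <->
  det3 [:: a; b; c] [:: a'; b'; c'] [:: a''; b''; c''] = 0.
Proof.
exact: (concurrent_line_of [:: a; b; c] [:: a'; b'; c'] [:: a''; b''; c'']).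
Qed.

Lemma lineP (L : line) : \dim L = 1%N -> exists x y z, L = line_of x y z.
Proof.
move=> dimL; have v0 : vpick L != 0.
  by rewrite vpick0; apply/eqP => L0; rewrite L0 dimv0 in dimL.
have -> : L = <[vpick L]>%VS.
  apply/esym/eqP; rewrite eqEdim dimL dim_vline v0 andbT.
  by rewrite -memvE memv_pick.
by rewrite {1}[vpick L]rV3E; do 3!eexists.
Qed.

Lemma dim_line_of (a b c : C) :
  [|| a != 0, b != 0 | c != 0] -> \dim (line_of a b c) = 1%N.
Proof.
move=> abc; rewrite /line_of dim_vline.
suff -> : linear_form a b c != 0 by [].
apply: contraL abc => /eqP/rowP v0.
have := v0 0; have := v0 1; have := v0 (ord_max).
by rewrite !mxE /= => -> -> ->; rewrite eqxx.
Qed.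

Lemma line_image_vline (g : 'M[C]_3) (v : 'rV[C]_3) :
  line_image g <[v]>%VS = <[v *m invmx g]>%VS.
Proof. by rewrite /line_image limg_line lfunE. Qed.

Lemma line_image1 (L : line) : line_image 1%:M L = L.
Proof.
rewrite /line_image -[RHS]lim1g; congr (_ @: _)%VS.
by apply/lfunP => v; rewrite !lfunE /= invmx1 mulmx1.
Qed.

Lemma line_imageM (g h : 'M[C]_3) (L : line) : g \in unitmx -> h \in unitmx ->
  line_image g (line_image h L) = line_image (g *m h) L.
Proof.
move=> gU hU; rewrite /line_image -limg_comp; congr (_ @: _)%VS.
apply/lfunP => v; rewrite comp_lfunE !lfunE /=.
apply: (canLR (mulmxK gU)); apply: (canLR (mulmxK hU)).
by rewrite -mulmxA mulmxKV // unitmx_mul gU.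
Qed.

Lemma line_imageK (g : 'M[C]_3) (L : line) : g \in unitmx ->
  line_image (invmx g) (line_image g L) = L.
Proof.
by move=> gU; rewrite line_imageM ?unitmx_inv // mulVmx // line_image1.
Qed.

Lemma dim_line_image (g : 'M[C]_3) (L : line) : g \in unitmx ->
  \dim (line_image g L) = \dim L.
Proof.
move=> gU; rewrite /line_image limg_dim_eq //.
apply/eqP; rewrite -subv0; apply/subvP => v /memv_capP[_].
rewrite memv_ker lfunE /= memv0 => /eqP vg.
by rewrite -[v](mulmxKV gU) vg mul0mx.
Qed.

Lemma lies_on_line_image (g : 'M[C]_3) (p : 'cV[C]_3) (L : line) :
  g \in unitmx -> lies_on p L -> lies_on (g *m p) (line_image g L).
Proof.
move=> gU pL w /memv_imgP[v vL ->].
by rewrite lfunE /= mulmxA mulmxKV // pL.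
Qed.

Lemma concurrent_line_image (g : 'M[C]_3) (L1 L2 L3 : line) : g \in unitmx ->
  concurrent (line_image g L1) (line_image g L2) (line_image g L3) <->
  concurrent L1 L2 L3.
Proof.
have img (h : 'M[C]_3) (M1 M2 M3 : line) :
    h \in unitmx -> concurrent M1 M2 M3 ->
    concurrent (line_image h M1) (line_image h M2) (line_image h M3).
  move=> hU [p [p0 p1 p2 p3]]; exists (h *m p).
  split; [|exact: (lies_on_line_image hU p1)|exact: (lies_on_line_image hU p2)
    |exact: (lies_on_line_image hU p3)].
  by move=> hp; apply: p0; rewrite -[p](mulKmx hU) hp mulmx0.
move=> gU; split; last exact: img.
by move/(img (invmx g)); rewrite !line_imageK // unitmx_inv => /(_ gU).
Qed.

(** Used to read distinctness of lines off the incidences: a repeated line would be concurrent with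
    every third line. *)
Lemma concurrent_eq (L M : line) : \dim L = 1%N -> \dim M = 1%N ->
  concurrent L L M.
Proof.
move=> /lineP[x [y [z ->]]] /lineP[x' [y' [z' ->]]].
by apply/concurrent_of3; rewrite /det3 /=; ring.
Qed.

(** The inverse of the coefficient matrix of the first three lines sends them to the coordinate
    lines; a diagonal matrix then fixes these and normalizes the fourth. *)
Lemma line_frame (L0 L1 L2 L3 : line) :
  \dim L0 = 1%N -> \dim L1 = 1%N -> \dim L2 = 1%N -> \dim L3 = 1%N ->
  ~ concurrent L0 L1 L2 -> ~ concurrent L0 L1 L3 ->
  ~ concurrent L0 L2 L3 -> ~ concurrent L1 L2 L3 ->
  exists g : 'M[C]_3, [/\ g \in unitmx, line_image g L0 = line_of 0 1 0,
    line_image g L1 = line_of 1 0 0, line_image g L2 = line_of 0 0 1 &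
    line_image g L3 = line_of 1 1 1].
Proof.
move=> /lineP[a0 [b0 [c0 e0]]] /lineP[a1 [b1 [c1 e1]]].
move=> /lineP[a2 [b2 [c2 e2]]] dim3 n012 n013 n023 n123.
(* [L1] comes first because it must go to [x = 0] and [L0] to [y = 0]; the swap changes the sign of
   the determinant below. *)
pose N := \matrix_(i < 3) nth 0 [:: linear_form a1 b1 c1; linear_form a0 b0 c0;
  linear_form a2 b2 c2] i.
have NU : N \in unitmx.
  rewrite unitmxE unitfE; apply/negP => /eqP d0; apply: n012.
  rewrite e0 e1 e2; apply/concurrent_of3; rewrite -[RHS]oppr0 -d0.
  rewrite det_mx33.
  rewrite !mxE /det3 /=; ring.
have NV i : row i N *m invmx N = delta_mx 0 i.
  by rewrite -row_mul mulmxV // row1.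
have deltaE (i : 'I_3) : delta_mx 0 i = @linear_form R (i == 0)%:R (i == 1)%:R
    (i == ord_max :> 'I_3)%:R.
  by rewrite [LHS]rV3E !mxE !eqxx !(eq_sym i).
have image (i : 'I_3) v : nth 0 [:: linear_form a1 b1 c1; linear_form a0 b0 c0;
    linear_form a2 b2 c2] i = v :> 'rV[C]_3 ->
    line_image N <[v]>%VS = @line_of R (i == 0)%:R (i == 1)%:R
    (i == ord_max :> 'I_3)%:R.
  by rewrite line_image_vline /line_of -deltaE -NV rowK => ->.
have m0 : line_image N L0 = line_of 0 1 0.
  by rewrite e0 (image 1).
have m1 : line_image N L1 = line_of 1 0 0.
  by rewrite e1 (image 0).
have m2 : line_image N L2 = line_of 0 0 1.
  by rewrite e2 (image ord_max).
have /lineP[p [q [r m3]]] : \dim (line_image N L3) = 1%N.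
  by rewrite dim_line_image.
(* A zero coefficient would make the fourth line pass through a vertex of the coordinate
   triangle. *)
have p0 : p != 0.
  apply/eqP => p0; apply: n023; apply/(concurrent_line_image _ _ _ NU).
  by rewrite m0 m2 m3; apply/concurrent_of3; rewrite /det3 p0 /=; ring.
have q0 : q != 0.
  apply/eqP => q0; apply: n123; apply/(concurrent_line_image _ _ _ NU).
  by rewrite m1 m2 m3; apply/concurrent_of3; rewrite /det3 q0 /=; ring.
have r0 : r != 0.
  apply/eqP => r0; apply: n013; apply/(concurrent_line_image _ _ _ NU).
  by rewrite m0 m1 m3; apply/concurrent_of3; rewrite /det3 r0 /=; ring.
pose D := diag_mx (linear_form p q r).
have DU : D \in unitmx.
  rewrite unitmxE unitfE det_diag !big_ord_recl big_ord0 !mxE /= mulr1.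
  by rewrite !mulf_neq0.
have DV x y z :
    linear_form x y z *m invmx D = linear_form (x / p) (y / q) (z / r).
  apply: (canLR (mulmxK DU)); apply/rowP => j; rewrite mul_mx_diag !mxE.
  by case: j => -[|[|[|//]]] lt /=; rewrite divfK.
have Dimage x y z :
    line_image D (line_of x y z) = line_of (x / p) (y / q) (z / r).
  by rewrite line_image_vline DV.
exists (D *m N); rewrite unitmx_mul DU NU -!line_imageM // m0 m1 m2 m3 !Dimage.
rewrite !mul0r !divff //; split=> //.
- by rewrite -(line_of_scale 0 1 0 (invr_neq0 q0)) !mulr0 mulr1 mul1r.
- by rewrite -(line_of_scale 1 0 0 (invr_neq0 p0)) !mulr0 mulr1 mul1r.
- by rewrite -(line_of_scale 0 0 1 (invr_neq0 r0)) !mulr0 mulr1 mul1r.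
Qed.

End Lines.

(** * The incidences of [arrM] and [arrA2] *)

Section Incidence.
Variable R : realType.
Local Notation C := R[i].
Local Notation line := {vspace 'rV[C]_3}.
Implicit Types (A B : 13.-tuple line) (k : C).

(** An explicit table as common reference: once [arrA2] satisfies it, having the same combinatorics
    with matching labels means satisfying it too. *)
Definition has_incidence B : Prop := forall i j k : 'I_13,
  uniq [:: i; j; k] ->
  (concurrent (tnth B i) (tnth B j) (tnth B k) <-> incident i j k).

(** Reduces the derivation of an equation from a vanishing factor to naming the cofactor [q]; [ring]
    or [field] does the rest. *)
Lemma eq_of_factor (q f x y : C) : f = 0 -> x - y = f * q -> x = y.
Proof. by move=> -> /eqP; rewrite mul0r subr_eq0 => /eqP. Qed.

(** Here [k ^+ 3 - 1] is [(k - 1) * (1 + k + k ^+ 2)] and [k1 * k2 - 1] is [(k - 1) * (k + 1)]. The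
    case [k1 = - k2] is void because [k] is nonzero. *)
Lemma admissible_factors1 k : k != 0 ->
  admissible (k ^+ 2) k k /\ k ^+ 2 <> -1 <->
  (forall f, f \in pfactors 1 -> peval k f != 0).
Proof.
move=> k0; split=> [[[[_ _ _] [k3 _ kk] /(_ erefl)[h1 h2 h3 h4 h5] _] hg]|h].
  apply/allP; rewrite /= andbT; apply/and5P; split; [| | | |apply/and5P; split];
    apply/eqP => f0.
  - by apply: k3; apply: (eq_of_factor (q := 1 + k + k ^+ 2) f0); ring.
  - by apply: k3; apply: (eq_of_factor (q := k - 1) f0); ring.
  - by apply: kk; apply: (eq_of_factor (q := k - 1) f0); ring.
  - by apply: hg; apply: (eq_of_factor (q := 1) f0); ring.
  - by apply: h1; apply: (eq_of_factor (q := 1) f0); ring.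
  - by apply: h2; apply: (eq_of_factor (q := 1) f0); ring.
  - by apply: h3; apply: (eq_of_factor (q := 1 / 2) f0); field.
  - by apply: h4; apply: (eq_of_factor (q := 1) f0); ring.
  - by apply: h5; apply: (eq_of_factor (q := 1) f0); ring.
have {h} /allP/= := h; rewrite andbT => /and5P[h1 h2 h3 hg].
move=> /and5P[/eqP ha /eqP hb /eqP hc /eqP hd /eqP he].
have k3 : k ^+ 3 <> 1.
  move/eqP; rewrite -subr_eq0; apply/negP.
  by move: (mulf_neq0 h1 h2); congr (_ != 0); ring.
have gN1 : k ^+ 2 <> -1.
  move/eqP; rewrite -subr_eq0; apply/negP.
  by move: hg; congr (_ != 0); ring.
split=> //; split; first by split=> //; apply/eqP; rewrite expf_neq0.
- split=> //; move/eqP; rewrite -subr_eq0; apply/negP.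
  by move: (mulf_neq0 h1 h3); congr (_ != 0); ring.
- move=> _; split=> p0.
  + by apply: ha; apply: (eq_of_factor (q := 1) p0); ring.
  + by apply: hb; apply: (eq_of_factor (q := 1) p0); ring.
  + by apply: hc; rewrite p0 /=; field.
  + by apply: hd; apply: (eq_of_factor (q := 1) p0); ring.
  + by apply: he; apply: (eq_of_factor (q := 1) p0); ring.
- by move/eqP; rewrite -addr_eq0 -mulr2n mulrn_eq0 (negPf k0).
Qed.

(** With [k2 = - k], the equation [k2 ^+ 3 = 1] reads [(k + 1) * (1 - k + k ^+ 2) = 0], and
    [k1 * k2 = 1] reads [k ^+ 2 = -1]. The case [k1 = k2] is void. *)
Lemma admissible_factorsN1 k : k != 0 ->
  admissible (k ^+ 2) k (- k) /\ k ^+ 2 <> -1 <->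
  (forall f, f \in pfactors (-1) -> peval k f != 0).
Proof.
move=> k0; split=> [[[[_ _ _] [k3 k3' kk] _
  /(_ (esym (opprK _)))[h1 h2 h3 h4 h5]] hg]|h].
  apply/allP; rewrite /= andbT.
  apply/and5P; split; [| | | |apply/and5P; split; [| | | |apply/andP; split]];
    apply/eqP => f0.
  - by apply: k3; apply: (eq_of_factor (q := 1 + k + k ^+ 2) f0); ring.
  - by apply: k3; apply: (eq_of_factor (q := k - 1) f0); ring.
  - by apply: k3'; apply: (eq_of_factor (q := - (1 - k + k ^+ 2)) f0); ring.
  - by apply: k3'; apply: (eq_of_factor (q := - (1 + k)) f0); ring.
  - by apply: hg; apply: (eq_of_factor (q := 1) f0); ring.
  - by apply: h1; apply: (eq_of_factor (q := 1) f0); ring.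
  - by apply: h2; apply: (eq_of_factor (q := 1) f0); ring.
  - by apply: h3; apply: (eq_of_factor (q := 1) f0); ring.
  - by apply: h4; apply: (eq_of_factor (q := 1) f0); ring.
  - by apply: h5; apply: (eq_of_factor (q := 1) f0); ring.
have {h} /allP/= := h; rewrite andbT => /and5P[h1 h2 h3 h4].
move=> /and5P[hg /eqP ha /eqP hb /eqP hc /andP[/eqP hd /eqP he]].
have gN1 : k ^+ 2 <> -1.
  move/eqP; rewrite -subr_eq0; apply/negP.
  by move: hg; congr (_ != 0); ring.
split=> //; split.
- by split=> //; [exact: sqrrN | apply/eqP; rewrite expf_neq0].
- split.
  + move/eqP; rewrite -subr_eq0; apply/negP.
    by move: (mulf_neq0 h1 h2); congr (_ != 0); ring.
  + move/eqP; rewrite -subr_eq0 -oppr_eq0; apply/negP.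
    by move: (mulf_neq0 h3 h4); congr (_ != 0); ring.
  + by move=> kk; apply: gN1; rewrite -kk; ring.
- by move/eqP; rewrite -addr_eq0 -mulr2n mulrn_eq0 (negPf k0).
- move=> _; split=> p0.
  + by apply: ha; apply: (eq_of_factor (q := 1) p0); ring.
  + by apply: hb; apply: (eq_of_factor (q := 1) p0); ring.
  + by apply: hc; apply: (eq_of_factor (q := 1) p0); ring.
  + by apply: hd; apply: (eq_of_factor (q := 1) p0); ring.
  + by apply: he; apply: (eq_of_factor (q := 1) p0); ring.
Qed.

Lemma admissible_factors (e : int) k : e = 1 \/ e = -1 -> k != 0 ->
  admissible (k ^+ 2) k (e%:~R * k) /\ k ^+ 2 <> -1 <->
  (forall f, f \in pfactors e -> peval k f != 0).
Proof.
move=> e1 k0; case: e1 => ->.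
  by rewrite mul1r; exact: admissible_factors1.
by rewrite mulN1r; exact: admissible_factorsN1.
Qed.

(** * Concurrency in [arrM] through integer minors *)

Definition pline (e : int) k (i : nat) : seq C :=
  map (peval k) (nth [::] (plines e) i).

Lemma arrM_pline (e : int) k (i : 'I_13) : e = 1 \/ e = -1 -> k != 0 ->
  let s := pline e k i in
  tnth (arrM (k ^+ 2) k (e%:~R * k)) i = line_of s`_0 s`_1 s`_2.
Proof.
move=> e1 k0 s.
have l0 : e%:~R * k != 0 by case: e1 => ->; rewrite ?mul1r ?mulN1r ?oppr_eq0.
have le : (e%:~R * k) * (e%:~R * k) = k ^+ 2 by case: e1 => ->; ring.
have kI : k * k^-1 = 1 by rewrite divff.
have lI : (e%:~R * k) * (e%:~R * k)^-1 = 1 by rewrite divff.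
set l := e%:~R * k in lI le l0 *.
(* The left side is what evaluating [[:: 0; e]] reduces to; it is folded back into [l]. *)
have lE : 0 + k * (e%:~R + k * 0) = l by rewrite /l; ring.
rewrite {}/s (tnth_nth 0%VS) /pline; case: i.
do 13?[case=> [lt13|]]; last (by []); rewrite /= ?mulr0z ?lE.
1-7: by congr line_of; ring.
- by apply: (line_of_eq (c := k)) => //; rewrite ?kI; ring.
- by congr line_of; ring.
- by apply: (line_of_eq (c := k)) => //; rewrite ?kI; ring.
- by apply: (line_of_eq (c := l)) => //; rewrite ?lI ?le; ring.
- by congr line_of; ring.
- by apply: (line_of_eq (c := l)) => //; rewrite ?lI; ring.
Qed.

Lemma arrM_concurrent (e : int) k (i j l : 'I_13) : e = 1 \/ e = -1 -> k != 0 ->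
  let B := arrM (k ^+ 2) k (e%:~R * k) in
  concurrent (tnth B i) (tnth B j) (tnth B l) <-> peval k (pminor e i j l) = 0.
Proof.
by move=> e1 k0 B; rewrite !arrM_pline // concurrent_line_of peval_pdet3.
Qed.

(** From left to right, a vanishing factor would annihilate the minor of a non-incident triple, by
    [factors_check]. From right to left, [incidence_check] says that incident minors vanish
    identically and that the others split into nonzero factors. *)
Lemma arrM_has_incidenceP (e : int) k : e = 1 \/ e = -1 -> k != 0 ->
  has_incidence (arrM (k ^+ 2) k (e%:~R * k)) <->
  (forall f, f \in pfactors e -> peval k f != 0).
Proof.
move=> e1 k0; split=> [inc f fP|fP i j l ijl].
  have /allP/(_ f fP) : factors_check e.
    by case: e1 => ->; [exact: factors_check1 | exact: factors_checkN1].
  case/hasP=> i; rewrite mem_iota => /andP[_ i13]; case/hasP=> j;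
  rewrite mem_iota => /andP[_ j13].
  case/hasP=> l; rewrite mem_iota => /andP[_ l13] /and3P[ijl nijl].
  case E: pdivide => [q|] // _; apply/eqP => f0.
  have := inc (Ordinal i13) (Ordinal j13) (Ordinal l13) ijl.
  rewrite arrM_concurrent //= (negPf nijl) (peval_pdivide k E) f0 mulr0.
  by case=> /(_ erefl).
rewrite arrM_concurrent //.
have /allP/(_ i) : incidence_check e.
  by case: e1 => ->; [exact: incidence_check1 | exact: incidence_checkN1].
rewrite mem_iota ltn_ord => /(_ isT)/allP/(_ j).
rewrite mem_iota ltn_ord => /(_ isT)/allP/(_ l).
rewrite mem_iota ltn_ord (_ : uniq _ = true) // => /(_ isT).
case: ifP => [_ /(peval_pzero k)|_ /(peval_splits k0 fP)/eqP] //.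
Qed.

Lemma arrM_has_incidence (g k1 k2 : C) :
  admissible g k1 k2 -> g <> -1 -> has_incidence (arrM g k1 k2).
Proof.
move=> adm gN1; have [[k1g k2g g0] _ _ _] := adm.
have k10 : k1 != 0 by apply/eqP => k0; apply: g0; rewrite -k1g k0 expr0n.
have [e e1 k2E] : exists2 e : int, e = 1 \/ e = -1 & k2 = e%:~R * k1.
  have /eqP : k2 ^+ 2 = k1 ^+ 2 by rewrite k1g k2g.
  rewrite eqf_sqr => /orP[] /eqP ->.
    by exists 1; [left | rewrite mul1r].
  by exists (-1); [right | rewrite mulN1r].
move: adm gN1; rewrite -{}k1g {}k2E => adm gN1.
by apply/(arrM_has_incidenceP e1 k10)/(admissible_factors e1 k10).
Qed.

Lemma has_incidence_admissible (g k1 k2 : C) : k1 != 0 -> k1 ^+ 2 = g ->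
  k2 ^+ 2 = g -> has_incidence (arrM g k1 k2) -> admissible g k1 k2 /\ g <> -1.
Proof.
move=> k10 <- /eqP; rewrite eqf_sqr => k21.
have [e e1 ->] : exists2 e : int, e = 1 \/ e = -1 & k2 = e%:~R * k1.
  case/orP: k21 => /eqP ->.
    by exists 1; [left | rewrite mul1r].
  by exists (-1); [right | rewrite mulN1r].
by move/(arrM_has_incidenceP e1 k10)/(admissible_factors e1 k10).
Qed.

(** * The arrangements [arrA2] *)

Lemma arrA2_arrM (a b : C) : a = 1 \/ a = -1 -> b = 1 \/ b = -1 ->
  arrA2 a b = arrM ((2 * a) ^+ 2) (2 * a) (2 * b).
Proof.
move=> ha hb; have aa : a * a = 1 by case: ha => ->; ring.
have bb : b * b = 1 by case: hb => ->; ring.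
have a0 : a != 0 by case: ha => ->; rewrite ?oppr_eq0 oner_eq0.
have b0 : b != 0 by case: hb => ->; rewrite ?oppr_eq0 oner_eq0.
have n2 : (2 : C) != 0 by rewrite pnatr_eq0.
have aI : a^-1 = a by rewrite -[LHS]mulr1 -aa mulrA mulVf ?mul1r.
have bI : b^-1 = b by rewrite -[LHS]mulr1 -bb mulrA mulVf ?mul1r.
have g4 : (2 * a) ^+ 2 = 4 by rewrite exprMn expr2 -[a ^+ 2]/(a * a) aa; ring.
rewrite g4; apply: eq_from_tnth => i; rewrite !(tnth_nth 0%VS).
case: i.
do 13?[case=> [lt13|]]; try (by []); rewrite /=.
- apply/esym/(line_of_eq (c := 2 * a));
    by rewrite ?mulf_neq0 ?divff ?mulf_neq0 ?mulr1.
- apply/esym/(line_of_eq (c := 2)); rewrite // ?invfM ?aI ?mulr1 //.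
  by rewrite mulrA divff // mul1r.
- apply/esym/(line_of_eq (c := 2 * b));
    rewrite ?mulf_neq0 ?divff ?mulf_neq0 ?mulr1 //.
  by rewrite mulrACA bb; ring.
- apply/esym/(line_of_eq (c := 2)); rewrite // ?invfM ?bI ?mulr1 //.
  by rewrite mulrA divff // mul1r.
Qed.

(** Pairs [(m, e)] where [m] is the value [2 * a] of [k1] and [e] is the sign with [k2 = e * k1]. *)
Definition arrA2_params : seq (int * int) :=
  [:: (2, 1); (2, -1); (-2, 1); (-2, -1)].

Lemma arrA2_factors :
  all (fun me : int * int => all (fun f => peval me.1 f != 0) (pfactors me.2))
    arrA2_params.
Proof. by vm_compute. Qed.

Lemma arrA2_has_incidence (a b : C) : a = 1 \/ a = -1 -> b = 1 \/ b = -1 ->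
  has_incidence (arrA2 a b).
Proof.
move=> ha hb; rewrite arrA2_arrM //.
(* The witnesses are [m = 2 * a] and [e = a * b]. *)
have [m [e [me -> ->]]] : exists m e : int,
    [/\ (m, e) \in arrA2_params, 2 * a = m%:~R &
        2 * b = e%:~R * m%:~R].
  by case: ha => ->; case: hb => ->;
    [exists 2, 1 | exists 2, (-1) | exists (-2), (-1) | exists (-2), 1];
    split=> //; ring.
have m0 : (m%:~R : C) != 0.
  by move: me; rewrite intr_eq0 !inE; case/or4P=> /eqP[-> _].
apply/arrM_has_incidenceP => //.
  by move: me; rewrite !inE; case/or4P=> /eqP[_ ->];
    [left | right | left | right].
move=> f fP; rewrite peval_int intr_eq0.
by have /allP/(_ _ me)/allP/(_ f fP) := arrA2_factors.
Qed.

End Incidence.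

(** * Moduli spaces and the normal form *)

Section Moduli.
Variable R : realType.
Local Notation C := R[i].
Local Notation line := {vspace 'rV[C]_3}.

Section Equivalence.
Variable n : nat.
Implicit Types (A B D : n.-tuple line) (s : 'S_n).

Lemma proj_equiv_sym A B : proj_equiv A B -> proj_equiv B A.
Proof.
case=> g gU ->; exists (invmx g); first by rewrite unitmx_inv.
by apply: eq_from_tnth => i; rewrite !tnth_map line_imageK.
Qed.

Lemma proj_equiv_trans A B D :
  proj_equiv A B -> proj_equiv B D -> proj_equiv A D.
Proof.
case=> g gU -> [h hU ->]; exists (h *m g); first by rewrite unitmx_mul hU.
by apply: eq_from_tnth => i; rewrite !tnth_map line_imageM.
Qed.

Lemma proj_class_eq A B : proj_equiv A B -> proj_class A = proj_class B.
Proof.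
move=> AB; apply/seteqP; split=> D; apply: proj_equiv_trans => //.
exact: proj_equiv_sym.
Qed.

Lemma proj_equiv_relabel s A B :
  proj_equiv A B -> proj_equiv (relabel s A) (relabel s B).
Proof.
case=> g gU ->; exists g => //.
by apply: eq_from_tnth => i; rewrite !(tnth_map, tnth_ord_tuple).
Qed.

Lemma relabelK s A : relabel (s^-1)%g (relabel s A) = A.
Proof.
by apply: eq_from_tnth => i; rewrite !(tnth_map, tnth_ord_tuple) permKV.
Qed.

Lemma arrangement_relabel s A : arrangement A -> arrangement (relabel s A).
Proof.
case=> uA dA; split=> [|i]; last by rewrite tnth_map tnth_ord_tuple.
rewrite map_inj_uniq ?enum_uniq // => i j eq_ij.
apply: (@perm_inj _ s); apply/eqP.
by rewrite -(inj_eq (tuple_uniqP _ uA)) eq_ij.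
Qed.

(** Absorbs an arbitrary bijection into the labelling, which reduces the unordered moduli space to
    the ordered one. *)
Lemma respects_incidence_relabel s A B :
  respects_incidence A B s <-> respects_incidence A (relabel s B) 1%g.
Proof.
by split=> AB i j k /AB; rewrite !(tnth_map, tnth_ord_tuple, perm1).
Qed.

End Equivalence.

Implicit Types (A B : 13.-tuple line).

Lemma respects_has_incidence A B : has_incidence A ->
  respects_incidence A B 1%g <-> has_incidence B.
Proof.
move=> incA; split=> [AB|incB] i j k ijk; last by rewrite !perm1 incA ?incB.
by rewrite -incA // AB // !perm1.
Qed.

(** If two of the lines were equal, they would be concurrent with every third line; but any two
    labels have, by inspection, a third one not incident with them. *)
Lemma arrM_arrangement (g k1 k2 : C) :
  has_incidence (arrM g k1 k2) -> arrangement (arrM g k1 k2).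
Proof.
move=> inc.
have dimM i : \dim (tnth (arrM g k1 k2) i) = 1%N.
  rewrite (tnth_nth 0%VS); case: i.
  do 13?[case=> [lt13|]]; try (by []);
    by rewrite /= dim_line_of // oner_eq0 ?orbT.
split=> //; apply/tuple_uniqP => i j eq_ij; apply/eqP/negPn/negP => nij.
have [l ijl nijl] : exists2 l : 'I_13, uniq [:: i; j; l] & ~~ incident i j l.
  have : all (fun i => all (fun j => (i == j) || has (fun l =>
      uniq [:: i; j; l] && ~~ incident i j l) (iota 0 13))
      (iota 0 13)) (iota 0 13).
    by vm_compute.
  move/allP/(_ i); rewrite mem_iota ltn_ord => /(_ isT)/allP/(_ j).
  rewrite mem_iota ltn_ord => /(_ isT); rewrite val_eqE (negPf nij).
  case/hasP=> l; rewrite mem_iota => /andP[_ l13] /andP[ijl nijl].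
  by exists (Ordinal l13).
apply/(negP nijl)/(inc i j l ijl); rewrite -eq_ij.
exact: concurrent_eq.
Qed.

Lemma has_incidence_line_image (g : 'M[C]_3) B : g \in unitmx ->
  has_incidence B -> has_incidence (map_tuple (line_image g) B).
Proof.
by move=> gU inc i j k ijk; rewrite !tnth_map concurrent_line_image // inc.
Qed.

(** In the coordinates of the frame, the pencils through [V_1] equate [X]-coefficients, those
    through [V_2] equate [Y]-coefficients, and those through [V_3] equate the ratios of [X] to
    [Y]. *)
Lemma normal_form B : arrangement B -> has_incidence B ->
  exists g k1 k2 : C,
    [/\ admissible g k1 k2, g <> -1 & proj_equiv (arrM g k1 k2) B].
Proof.
move=> [_ dimB] incB.
pose o m : 'I_13 := inord m.
have ncB i j k : (i < 13)%N -> (j < 13)%N -> (k < 13)%N -> uniq [:: i; j; k] ->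
    ~~ incident i j k ->
    ~ concurrent (tnth B (o i)) (tnth B (o j)) (tnth B (o k)).
  move=> i13 j13 k13 ijk nijk.
  have := incB (o i) (o j) (o k).
  rewrite /= !inE -!val_eqE /= !inordK // => inc.
  by rewrite /= !inE in ijk; rewrite (inc ijk); apply/negP.
have [g [gU g0 g1 g2 g3]] := line_frame
  (dimB (o 0%N)) (dimB (o 1%N)) (dimB (o 2%N)) (dimB (o 3%N))
  (ncB 0%N 1%N 2%N isT isT isT isT isT) (ncB 0%N 1%N 3%N isT isT isT isT isT)
  (ncB 0%N 2%N 3%N isT isT isT isT isT) (ncB 1%N 2%N 3%N isT isT isT isT isT).
pose B' := map_tuple (line_image g) B.
have incB' : has_incidence B' by exact: has_incidence_line_image.
have BB' : proj_equiv B B' by exists g.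
pose L m := tnth B' (o m).
have inc i j k : (i < 13)%N -> (j < 13)%N -> (k < 13)%N -> uniq [:: i; j; k] ->
    concurrent (L i) (L j) (L k) <-> incident i j k.
  move=> i13 j13 k13 ijk.
  have := incB' (o i) (o j) (o k).
  rewrite /= !inE -!val_eqE /= !inordK // => incijk.
  by rewrite /= !inE in ijk; exact: incijk.
have [L0 L1 L2 L3] : [/\ L 0%N = line_of 0 1 0, L 1%N = line_of 1 0 0,
    L 2%N = line_of 0 0 1 & L 3%N = line_of 1 1 1] by rewrite /L !tnth_map.
(* No remaining line passes through a vertex of the triangle [V_1], [V_2], [V_3], so all three
   coefficients are nonzero and the last one can be scaled to 1. *)
have affine m : (3 < m < 13)%N -> exists xy : C * C,
    [/\ xy.1 != 0, xy.2 != 0 & L m = line_of xy.1 xy.2 1].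
  move=> /andP[m3 m13].
  have /lineP[x [y [z Lm]]] : \dim (L m) = 1%N.
    by rewrite /L tnth_map dim_line_image.
  have [nx ny nz] : [/\ uniq [:: 0; 2; m] /\ ~~ incident 0 2 m,
      uniq [:: 1; 2; m] /\ ~~ incident 1 2 m &
      uniq [:: 0; 1; m] /\ ~~ incident 0 1 m]%N.
    by move: m3 m13 {Lm}; do 13?[case: m => [|m] //].
  have z0 : z != 0.
    apply/eqP => z0; apply/(negP nz.2)/(inc 0%N 1%N m) => //; first exact: nz.1.
    by rewrite L0 L1 Lm; apply/concurrent_of3; rewrite /det3 z0 /=; ring.
  have x0 : x != 0.
    apply/eqP => x0; apply/(negP nx.2)/(inc 0%N 2%N m) => //; first exact: nx.1.
    by rewrite L0 L2 Lm; apply/concurrent_of3; rewrite /det3 x0 /=; ring.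
  have y0 : y != 0.
    apply/eqP => y0; apply/(negP ny.2)/(inc 1%N 2%N m) => //; first exact: ny.1.
    by rewrite L1 L2 Lm; apply/concurrent_of3; rewrite /det3 y0 /=; ring.
  exists (x / z, y / z); rewrite /= !mulf_neq0 ?invr_eq0 //; split=> //.
  rewrite Lm -(line_of_scale (x / z) (y / z) 1 z0).
  by rewrite mulr1 ![z * _]mulrC !divfK.
(* The value 1 at index 3 treats [S_1] on a par with the other lines; values outside the range are
   arbitrary. *)
have {affine} [X [Y [X3 Y3 LE]]] : exists X Y : nat -> C,
    [/\ X 3%N = 1, Y 3%N = 1 & forall m, (2 < m < 13)%N ->
      [/\ X m != 0, Y m != 0 & L m = line_of (X m) (Y m) 1]].
  have [f fP] : exists f : nat -> C * C, forall m, (3 < m < 13)%N ->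
      [/\ (f m).1 != 0, (f m).2 != 0 & L m = line_of (f m).1 (f m).2 1].
    suff /choice[f fP] : forall m, exists xy : C * C, (3 < m < 13)%N ->
      [/\ xy.1 != 0, xy.2 != 0 & L m = line_of xy.1 xy.2 1] by exists f.
    move=> m.
    case: (boolP (3 < m < 13)%N) => [/affine[xy xyP]|_]; last by exists 0.
    by exists xy.
  exists (fun m => if m == 3%N then 1 else (f m).1),
    (fun m => if m == 3%N then 1 else (f m).2); split=> // m /=.
  case: (eqVneq m 3%N) => [-> _|m3]; first by rewrite oner_eq0.
  by rewrite leq_eqVlt eq_sym (negPf m3) => /fP.
have eqX i j : (2 < i < 13)%N -> (2 < j < 13)%N -> uniq [:: 0; i; j]%N ->
    incident 0 i j -> X i = X j.
  move=> hi hj ij; have [/andP[_ i13] /andP[_ j13]] := (hi, hj).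
  have [[_ _ Li] [_ _ Lj]] := (LE _ hi, LE _ hj).
  move/(inc 0%N i j isT i13 j13 ij).
  rewrite L0 Li Lj => /concurrent_of3/eq_of_factor.
  by apply; apply: (_ : _ = _ * -1); rewrite /det3 /=; ring.
have eqY i j : (2 < i < 13)%N -> (2 < j < 13)%N -> uniq [:: 1; i; j]%N ->
    incident 1 i j -> Y i = Y j.
  move=> hi hj ij; have [/andP[_ i13] /andP[_ j13]] := (hi, hj).
  have [[_ _ Li] [_ _ Lj]] := (LE _ hi, LE _ hj).
  move/(inc 1%N i j isT i13 j13 ij).
  rewrite L1 Li Lj => /concurrent_of3/eq_of_factor.
  by apply; apply: (_ : _ = _ * 1); rewrite /det3 /=; ring.
have eqXY i j : (2 < i < 13)%N -> (2 < j < 13)%N -> uniq [:: 2; i; j]%N ->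
    incident 2 i j -> X i * Y j = X j * Y i.
  move=> hi hj ij; have [/andP[_ i13] /andP[_ j13]] := (hi, hj).
  have [[_ _ Li] [_ _ Lj]] := (LE _ hi, LE _ hj).
  move/(inc 2%N i j isT i13 j13 ij).
  rewrite L2 Li Lj => /concurrent_of3/eq_of_factor.
  by apply; apply: (_ : _ = _ * 1); rewrite /det3 /=; ring.
have X5 : X 5%N = 1 by rewrite -X3; apply: eqX.
have X8 : X 8%N = 1 by rewrite -X3; apply: eqX.
have X12 : X 12%N = 1 by rewrite -X3; apply: eqX.
have X6 : X 6%N = X 4%N by apply: eqX.
have X9 : X 9%N = X 7%N by apply: eqX.
have X11 : X 11%N = X 10%N by apply: eqX.
have Y6 : Y 6%N = 1 by rewrite -Y3; apply: eqY.
have Y9 : Y 9%N = 1 by rewrite -Y3; apply: eqY.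
have Y11 : Y 11%N = 1 by rewrite -Y3; apply: eqY.
have Y5 : Y 5%N = Y 4%N by apply: eqY.
have Y8 : Y 8%N = Y 7%N by apply: eqY.
have Y12 : Y 12%N = Y 10%N by apply: eqY.
have Y4 : Y 4%N = X 4%N.
  by have := eqXY 3%N 4%N isT isT isT isT; rewrite X3 Y3 mul1r mulr1.
have XY7 : X 7%N * Y 7%N = 1.
  by have := eqXY 8%N 9%N isT isT isT isT; rewrite X8 Y8 X9 Y9 mulr1 => <-.
have X4 : Y 7%N = X 7%N * X 4%N.
  by have := eqXY 5%N 7%N isT isT isT isT; rewrite X5 Y5 Y4 mul1r.
have XY10 : X 10%N * Y 10%N = 1.
  by have := eqXY 11%N 12%N isT isT isT isT; rewrite X11 Y12 X12 Y11 mulr1.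
have X4' : X 4%N * Y 10%N = X 10%N.
  by have := eqXY 6%N 10%N isT isT isT isT; rewrite X6 Y6 mulr1.
(* Read off from [S_5], with coefficients [k1^-1, k1, 1], and [S_8], with coefficients
   [k2, k2^-1, 1]; the role of [g] falls to [X 4]. *)
pose k1 := Y 7%N; pose k2 := X 10%N.
have k10 : k1 != 0 by have [] := LE 7%N isT.
have k20 : k2 != 0 by have [] := LE 10%N isT.
have X7 : X 7%N = k1^-1 by apply: (mulIf k10); rewrite mulVf.
have Y10 : Y 10%N = k2^-1 by apply: (mulfI k20); rewrite divff.
have k1g : k1 ^+ 2 = X 4%N by rewrite expr2 {2}/k1 X4 X7 mulrA divff ?mul1r.
have k2g : k2 ^+ 2 = X 4%N by rewrite expr2 {1}/k2 -X4' Y10 divfK.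
have B'M : B' = arrM (X 4%N) k1 k2.
  apply: eq_from_tnth => i; have <- : o i = i by rewrite /o inord_val.
  rewrite -/(L i) (tnth_nth 0%VS) inordK //; case: i.
  case=> [lt13|]; first exact: L0.
  case=> [lt13|]; first exact: L1.
  case=> [lt13|]; first exact: L2.
  case=> [lt13|]; first exact: L3.
  do 9?[case=> [lt13|]]; try (by []); rewrite /=;
    match goal with |- L ?m = _ => have [_ _ ->] := LE m isT end;
    by rewrite ?(X5, X8, X12, X6, X9, X11, X7)
      ?(Y6, Y9, Y11, Y5, Y8, Y12, Y4, Y10).
(* The inequalities follow from the absence of further concurrencies in [B']. *)
move: incB'; rewrite B'M => /(has_incidence_admissible k10 k1g k2g)[adm gN1].
exists (X 4%N), k1, k2; split=> //; apply: proj_equiv_sym; rewrite -B'M //.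
Qed.

End Moduli.

Theorem theorem4p2 (R : realType) (a b : R[i])
  (ha : a = 1 \/ a = -1) (hb : b = 1 \/ b = -1) :
  ordered_moduli_space (arrA2 a b) =
    [set X | exists g k1 k2 : R[i],
       [/\ admissible g k1 k2, g <> -1 & X = proj_class (arrM g k1 k2)]]
  /\
  moduli_space (arrA2 a b) =
    [set X | exists (g k1 k2 : R[i]) (s : 'S_13),
       [/\ admissible g k1 k2, g <> -1 &
           X = proj_class (relabel s (arrM g k1 k2))]].
Proof.
have incA := arrA2_has_incidence ha hb.
have ordered B : arrangement B -> respects_incidence (arrA2 a b) B 1%g ->
    exists g k1 k2 : R[i],
      [/\ admissible g k1 k2, g <> -1 & proj_equiv (arrM g k1 k2) B].
  by move=> arrB /(respects_has_incidence _ incA); exact: normal_form.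
have arrM_ordered (g k1 k2 : R[i]) : admissible g k1 k2 -> g <> -1 ->
    arrangement (arrM g k1 k2) /\
    respects_incidence (arrA2 a b) (arrM g k1 k2) 1%g.
  move=> adm gN1; have incM := arrM_has_incidence adm gN1.
  by split; [exact: arrM_arrangement | exact/(respects_has_incidence _ incA)].
split; apply/seteqP; split=> X.
- case=> B [arrB AB] <-; have [g [k1 [k2 [adm gN1 MB]]]] := ordered B arrB AB.
  by exists g, k1, k2; split=> //; exact/esym/proj_class_eq.
- case=> g [k1 [k2 [adm gN1 ->]]]; exists (arrM g k1 k2) => //.
  exact: arrM_ordered.
- case=> B [arrB [s AB]] <-.
  (* The relabelled arrangement matches [arrA2] line by line, so it has a normal form; relabelling
     by [s^-1] returns to [B]. *)
  have [g [k1 [k2 [adm gN1 MB]]]] := ordered (relabel s B)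
    (arrangement_relabel s arrB) ((respects_incidence_relabel s _ B).1 AB).
  exists g, k1, k2, (s^-1)%g; split=> //; apply/esym/proj_class_eq.
  by rewrite -[B in proj_equiv _ B](relabelK s); exact: proj_equiv_relabel.
- case=> g [k1 [k2 [s [adm gN1 ->]]]]; exists (relabel s (arrM g k1 k2)) => //.
  have [arrB AB] := arrM_ordered g k1 k2 adm gN1.
  split; first exact: arrangement_relabel.
  exists (s^-1)%g; apply/respects_incidence_relabel.
  by rewrite relabelK.
Qed.
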